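(* Let $\alpha>-1$, $A\ge a>0$, and let $f$ and $f_{a,A}$ be as in the context. If there exists a weak solution $u$ of $$-\frac{d}{dx}\big(|u'|^\alpha u'\big)=(1+\alpha)f_{a,A}(u)\quad\text{in }\mathbb{R}$$ satisfying $\lim_{x\to+\infty}u(x)=1$ and $\lim_{x\to-\infty}u(x)=-1$, then necessarily $$\int_{-1}^1f_{a,A}(s)\,ds=0.$$
   Context: Assumptions on $f$: $f\in\mathcal{C}^1([-1,1])$, $f(-1)=f(0)=f(1)=0$, $f>0$ on $(0,1)$, $f<0$ on $(-1,0)$, $f'(\pm1)<0$; $f$ is extended outside $[-1,1]$ so that $f\in\mathcal{C}^{0,1}(\mathbb{R})$, $f\ge0$ on $(-\infty,-1)$ and $f\le0$ on $[1,+\infty)$. Define $f_{a,A}(t)=f(t)/a$ if $f(t)>0$, $f_{a,A}(t)=f(t)/A$ if $f(t)<0$, and $f_{a,A}(t)=0$ if $f(t)=0$. It is also assumed that $\int_t^1f_{a,A}(s)\,ds>0$ for all $t\in(-1,0]$. A weak solution is a $\mathcal{C}^1$ function $u:\mathbb{R}\to\mathbb{R}$ satisfying the equation in the distribution sense. *)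

(* Defs.v *)
From Stdlib Require Import Reals.
From Coquelicot Require Import Coquelicot.
Local Open Scope R_scope.

(* Derivative relative to [D]: at an endpoint of a closed interval this is the
   one-sided derivative. *)
Definition is_derive_on (D : R -> Prop) (g : R -> R) (x l : R) : Prop :=
  filterlim (fun y => (g y - g x) / (y - x))
    (within D (locally' x)) (locally l).

(* [g] is of class C^1 on [D], with derivative [dg]. *)
Definition is_C1_on (D : R -> Prop) (g dg : R -> R) : Prop :=
  (forall x, D x -> is_derive_on D g x (dg x)) /\ continuous_on D dg.

Definition C1 (u : R -> R) : Prop :=
  (forall x, ex_derive u x) /\ (forall x, continuous (Derive u) x).

Definition Lipschitz (g : R -> R) : Prop :=
  exists L, forall x y, Rabs (g x - g y) <= L * Rabs (x - y).

Definition f_aA (a A : R) (f : R -> R) (t : R) : R :=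
  if Rlt_dec 0 (f t) then f t / a
  else if Rlt_dec (f t) 0 then f t / A
  else 0.

(* |p|^alpha p.  [Rpower 0 alpha] is a default value, but the factor [p] makes
   [flux alpha 0 = 0], which is the continuous extension for [alpha > -1]. *)
Definition flux (alpha p : R) : R := Rpower (Rabs p) alpha * p.

(* C^oo functions with compact support. *)
Definition test_function (phi : R -> R) : Prop :=
  (forall n x, ex_derive_n phi n x) /\
  (exists M, forall x, M < Rabs x -> phi x = 0).

Definition integral_R (g : R -> R) : R :=
  RInt_gen g (Rbar_locally m_infty) (Rbar_locally p_infty).

(* C^1 solutions of - (|u'|^alpha u')' = g(u) in the sense of distributions.
   For [u] of class C^1, [g] continuous and [alpha > -1], both integrands are
   continuous with compact support, so both integrals exist. *)
Definition weak_solution (alpha : R) (g u : R -> R) : Prop :=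
  C1 u /\
  forall phi, test_function phi ->
    integral_R (fun x => flux alpha (Derive u x) * Derive phi x) =
    integral_R (fun x => g (u x) * phi x).

(* Main.v *)
Require Import Defs.
From Stdlib Require Import Reals.
From Coquelicot Require Import Coquelicot.
From Stdlib Require Import Lra Lia.
Local Open Scope R_scope.

(** With [w = |u'|^alpha u'] and [g = (1 + alpha) f_aA], the du Bois-Reymond
    lemma makes [w] of class C^1 with [w' = - g(u)].  Multiplying by [u'], which
    is [|w|^beta w] for [1 + beta = 1 / (1 + alpha)], shows that the energy
    [|w|^(beta + 2) + (beta + 2) G(u)], [G' = g], is constant.  Since [u] converges at
    both infinities, the mean value theorem gives points arbitrarily far out
    where [u'] is small, so the energy equals both [(beta + 2) G(1)] and
    [(beta + 2) G(-1)].  The energy is differentiated in [w] and not in [u'], which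
    need not be differentiable. *)

(** * Finite-order differentiability *)

(** Each derivative is carried as an explicit function, so closure under sums and products is a
    direct induction. *)
Fixpoint diff_n (n : nat) (f : R -> R) : Prop :=
  match n with
  | O => True
  | S m => exists g, (forall x, is_derive f x (g x)) /\ diff_n m g
  end.

Lemma diff_n_pred n : forall f, diff_n (S n) f -> diff_n n f.
Proof.
  induction n as [|n IH]; intros f [g [Hg Cg]]; [exact I|].
  exists g; split; [exact Hg | now apply IH].
Qed.

Lemma diff_n_const n : forall c : R, diff_n n (fun _ => c).
Proof.
  induction n as [|n IH]; intros c; [exact I|].
  exists (fun _ => 0); split; [intros x; apply @is_derive_const | apply IH].
Qed.

Lemma diff_n_plus n : forall f g, diff_n n f -> diff_n n g -> diff_n n (fun x => f x + g x).
Proof.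
  induction n as [|n IH]; intros f g; [easy|].
  intros [f' [Df Cf]] [g' [Dg Cg]].
  exists (fun x => f' x + g' x); split; [|now apply IH].
  intros x; now apply @is_derive_plus.
Qed.

Lemma diff_n_mult n : forall f g, diff_n n f -> diff_n n g -> diff_n n (fun x => f x * g x).
Proof.
  induction n as [|n IH]; intros f g; [easy|].
  intros Hf Hg; pose proof (diff_n_pred _ _ Hf); pose proof (diff_n_pred _ _ Hg).
  destruct Hf as [f' [Df Cf]], Hg as [g' [Dg Cg]].
  exists (fun x => f' x * g x + f x * g' x); split.
  - intros x; apply @is_derive_mult; auto using Rmult_comm.
  - apply diff_n_plus; now apply IH.
Qed.

(** [diff_n] peels off the innermost derivative and [ex_derive_n] the outermost; [Derive_n_comp]
    exchanges the two. *)
Lemma ex_derive_n_of_diff_n n : forall f x, diff_n n f -> ex_derive_n f n x.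
Proof.
  destruct n as [|n]; [easy|].
  induction n as [|n IH]; intros f x [g [Hg Cg]]; simpl.
  - now exists (g x).
  - specialize (IH g x Cg); simpl in IH.
    apply (ex_derive_ext (Derive_n g n)); [|exact IH].
    intros t; transitivity (Derive_n (Derive_n f 1) n t).
    + apply Derive_n_ext; intros s; symmetry; apply is_derive_unique, Hg.
    + rewrite Derive_n_comp; now rewrite Nat.add_1_r.
Qed.

(** * Smooth bump functions *)

(** The difference quotient at 0 is bounded by [C * Rabs x]. This handles the point where the two
    branches of [flat] meet. *)
Lemma is_derive_0_of_quadratic (h : R -> R) (C : R) :
  (forall x, Rabs (h x) <= C * x ^ 2) -> is_derive h 0 0.
Proof.
  intros H.
  assert (h0 : h 0 = 0).
  { specialize (H 0); replace (C * 0 ^ 2) with 0 in H by ring.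
    generalize (Rabs_pos (h 0)); intros.
    destruct (Req_dec (h 0) 0) as [|N]; [easy|].
    apply Rabs_pos_lt in N; lra. }
  apply is_derive_Reals; intros eps Heps.
  assert (HC : 0 < Rabs C + 1) by (generalize (Rabs_pos C); lra).
  exists (mkposreal _ (Rdiv_lt_0_compat _ _ Heps HC)); simpl; intros k k0 Hk.
  rewrite Rplus_0_l, h0, !Rminus_0_r, Rabs_div by easy.
  apply Rabs_pos_lt in k0.
  apply Rlt_div_l; [easy|].
  apply Rlt_div_r in Hk; [|easy].
  specialize (H k); rewrite <- pow2_abs in H.
  generalize (Rle_abs C); intros; nra.
Qed.

(* The factor [(/ x) ^ k] makes the span of the family closed under
   differentiation, which gives smoothness. *)
Definition flat (k : nat) (x : R) : R :=
  if Rlt_dec 0 x then (/ x) ^ k * exp (- / x) else 0.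

Lemma flat_nonneg k x : 0 <= flat k x.
Proof.
  unfold flat; destruct Rlt_dec as [Hx|]; [|lra].
  apply Rmult_le_pos; [apply pow_le, Rlt_le, Rinv_0_lt_compat, Hx|].
  apply Rlt_le, exp_pos.
Qed.

Lemma flat_pos k x : 0 < x -> 0 < flat k x.
Proof.
  intros Hx; unfold flat; destruct Rlt_dec; [|lra].
  apply Rmult_lt_0_compat; [apply pow_lt, Rinv_0_lt_compat, Hx | apply exp_pos].
Qed.

Lemma flat_nonpos k x : x <= 0 -> flat k x = 0.
Proof. unfold flat; destruct Rlt_dec; lra. Qed.

(** Since [exp y] is the [m]-th power of [exp (y / INR m)], the bound reduces to [t <= exp t] at
    [t = y / INR m]. *)
Lemma pow_mult_exp_opp_le (m : nat) (y : R) :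
  (0 < m)%nat -> 0 <= y -> y ^ m * exp (- y) <= INR m ^ m.
Proof.
  intros Hm Hy.
  assert (HM : 0 < INR m) by now apply lt_0_INR.
  assert (E : exp y = exp (y / INR m) ^ m).
  { assert (G : forall k t, exp t ^ k = exp (INR k * t)).
    { induction k as [|k IH]; intros t.
      - simpl; rewrite Rmult_0_l; now rewrite exp_0.
      - rewrite S_INR; simpl; rewrite IH, <- exp_plus; f_equal; ring. }
    rewrite G; f_equal; field; lra. }
  rewrite exp_Ropp; apply Rle_div_l; [apply exp_pos|].
  rewrite E, <- Rpow_mult_distr.
  apply pow_incr; split; [easy|].
  assert (0 <= y / INR m) by (apply Rdiv_le_0_compat; lra).
  assert (y / INR m <= exp (y / INR m)).
  { generalize (exp_ineq1_le (y / INR m)); lra. }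
  replace y with (INR m * (y / INR m)) at 1 by (field; lra).
  apply Rmult_le_compat_l; lra.
Qed.

Lemma flat_derive k x :
  is_derive (flat k) x (flat (k + 2) x - INR k * flat (k + 1) x).
Proof.
  destruct (Rtotal_order x 0) as [Hx|[Hx|Hx]].
  - rewrite !flat_nonpos by lra.
    replace (0 - INR k * 0) with 0 by ring.
    apply (is_derive_ext_loc (fun _ => 0)); [|apply @is_derive_const].
    apply (filter_imp (fun y => y < 0)); [|now apply open_lt].
    intros y Hy; now rewrite flat_nonpos by lra.
  - subst x; rewrite !flat_nonpos by lra.
    replace (0 - INR k * 0) with 0 by ring.
    (* The exponential bound with exponent [k + 2] instead of [k] leaves the factor [x ^ 2] over. *)
    apply (is_derive_0_of_quadratic _ (INR (k + 2) ^ (k + 2))); intros x.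
    rewrite Rabs_pos_eq by apply flat_nonneg.
    destruct (Rlt_dec 0 x) as [Hx|Hx].
    + unfold flat; destruct Rlt_dec; [|lra].
      assert (Hi : 0 <= / x) by (apply Rlt_le, Rinv_0_lt_compat, Hx).
      generalize (pow_mult_exp_opp_le (k + 2) (/ x) ltac:(lia) Hi); intros H.
      apply (Rmult_le_compat_r (x ^ 2)) in H; [|apply pow2_ge_0].
      eapply Rle_trans; [|exact H]; right.
      rewrite pow_add; field; lra.
    + rewrite flat_nonpos by lra.
      apply Rmult_le_pos; [apply pow_le, pos_INR | apply pow2_ge_0].
  - apply (is_derive_ext_loc (fun y => (/ y) ^ k * exp (- / y))).
    + apply (filter_imp (fun y => 0 < y)); [|now apply open_gt].
      intros y Hy; unfold flat; destruct Rlt_dec; [easy|lra].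
    + unfold flat; destruct Rlt_dec; [|lra].
      auto_derive; [repeat split; lra|].
      (* The power rule produces the exponent [pred k], hence the case split. *)
      destruct k as [|k]; simpl pred.
      * simpl; field; lra.
      * rewrite !pow_add, S_INR; simpl; field; lra.
Qed.

(** The induction needs all [k] at once, as differentiation raises the index. The slope [s] allows
    for the reflected factor in [bump]. *)
Lemma diff_n_flat_affine n : forall k s t, diff_n n (fun x => flat k (s * x + t)).
Proof.
  induction n as [|n IH]; intros k s t; [exact I|].
  exists (fun x => s * flat (k + 2) (s * x + t)
                   + - (s * INR k) * flat (k + 1) (s * x + t)); split.
  - intros x.
    evar_last.
    { apply (is_derive_comp (flat k) (fun x => s * x + t)).
      - apply flat_derive.
      - auto_derive; [easy|reflexivity]. }
    unfold scal; simpl; unfold mult; simpl; ring.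
  - apply diff_n_plus; apply diff_n_mult; auto using diff_n_const.
Qed.

(** Inside the interval of centre [c] and radius [d] this is exp(-1/(x-c+d)) exp(-1/(c+d-x)). The
    coefficients [1] and [-1] are kept to match [diff_n_flat_affine]. *)
Definition bump (d c x : R) : R :=
  flat 0 (1 * x + (d - c)) * flat 0 (-1 * x + (d + c)).

Lemma diff_n_bump n d c : diff_n n (bump d c).
Proof. apply diff_n_mult; apply diff_n_flat_affine. Qed.

Lemma bump_nonneg d c x : 0 <= bump d c x.
Proof. apply Rmult_le_pos; apply flat_nonneg. Qed.

Lemma bump_pos d c x : Rabs (x - c) < d -> 0 < bump d c x.
Proof.
  intros H%Rabs_def2; apply Rmult_lt_0_compat; apply flat_pos; lra.
Qed.

Lemma bump_outside d c x : d <= Rabs (x - c) -> bump d c x = 0.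
Proof.
  unfold bump; intros H; destruct (Rle_dec x (c - d)).
  - rewrite (flat_nonpos 0 (1 * x + _)) by lra; ring.
  - rewrite (flat_nonpos 0 (-1 * x + _)); [ring|].
    unfold Rabs in H; destruct Rcase_abs; lra.
Qed.

Lemma bump_translate d c x : bump d c x = bump d 0 (x - c).
Proof. unfold bump; f_equal; f_equal; ring. Qed.

Lemma bump_continuous d c x : continuous (bump d c) x.
Proof.
  destruct (diff_n_bump 1 d c) as [g [Hg _]].
  apply @ex_derive_continuous; now exists (g x).
Qed.

(** * Integrals of continuous functions with bounded support *)

Lemma ex_RInt_cont (h : R -> R) a b : (forall x, continuous h x) -> ex_RInt h a b.
Proof. intros H; apply @ex_RInt_continuous; auto. Qed.

Lemma is_derive_RInt_cont (h : R -> R) a x :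
  (forall x, continuous h x) -> is_derive (RInt h a) x (h x).
Proof.
  intros H; apply (is_derive_RInt h _ a); [|apply H].
  apply filter_forall; intros y; now apply @RInt_correct, ex_RInt_cont.
Qed.

Lemma RInt_supp (h : R -> R) a b a' b' :
  (forall x, continuous h x) -> a' <= a -> b <= b' ->
  (forall x, x <= a \/ b <= x -> h x = 0) -> RInt h a' b' = RInt h a b.
Proof.
  intros Hc Ha Hb Hs.
  assert (Z : forall s t, s <= t -> t <= a \/ b <= s -> RInt h s t = 0).
  { intros s t Hst Ht; rewrite (RInt_ext _ (fun _ => 0)).
    - rewrite RInt_const; apply Rmult_0_r.
    - intros x; rewrite Rmin_left, Rmax_right by easy; intros; apply Hs; lra. }
  rewrite <- (RInt_Chasles h a' a b'), <- (RInt_Chasles h a b b')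
    by now apply ex_RInt_cont.
  rewrite (Z a' a), (Z b b') by (try easy; lra).
  unfold plus; simpl; ring.
Qed.

(** The integral from [s] to [t] no longer changes once [s < - M] and [M < t], so the limit defining
    [integral_R] is attained. *)
Lemma integral_R_supp (h : R -> R) M :
  (forall x, continuous h x) -> (forall x, M <= Rabs x -> h x = 0) ->
  integral_R h = RInt h (- M) M.
Proof.
  intros Hc Hs; apply is_RInt_gen_unique.
  intros P HP.
  exists (fun x => x < - M) (fun x => M < x).
  - now exists (- M).
  - now exists M.
  - intros s t Hx Hy; exists (RInt h (- M) M); split.
    + rewrite <- (RInt_supp h (- M) M s t); simpl; try lra; auto.
      * now apply @RInt_correct, ex_RInt_cont.
      * intros x [H|H]; apply Hs; unfold Rabs; destruct Rcase_abs; lra.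
    + now apply locally_singleton.
Qed.

(** * Test functions and the du Bois-Reymond lemma *)

Lemma test_function_C1 phi : test_function phi -> Defs.C1 phi.
Proof.
  intros [H _]; split; intros x; [apply (H 1%nat)|].
  apply @ex_derive_continuous, (H 2%nat).
Qed.

Lemma Derive_supp (phi : R -> R) M x :
  (forall y, M < Rabs y -> phi y = 0) -> M < Rabs x -> Derive phi x = 0.
Proof.
  intros H Hx; rewrite (Derive_ext_loc phi (fun _ => 0)); [apply Derive_const|].
  apply (filter_imp (fun y => M < Rabs y)); [exact H|].
  apply (open_comp Rabs (fun y => M < y)); [|apply open_gt|exact Hx].
  intros y _; apply continuous_Rabs.
Qed.

(** Taking [N] strictly beyond the support bound makes [phi] and its derivative vanish at the
    endpoints too, which removes boundary terms. [B] serves to enclose a prescribed point. *)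
Lemma test_function_supp phi B : test_function phi ->
  exists N, B < N /\ 0 < N /\ phi N = 0 /\ phi (- N) = 0 /\
    forall x, N <= Rabs x -> phi x = 0 /\ Derive phi x = 0.
Proof.
  intros [_ [M HM]]; exists (Rabs M + Rabs B + 1).
  set (N := _ + 1).
  assert (HN : M < N /\ B < N /\ 0 < N).
  { generalize (Rle_abs M) (Rle_abs B) (Rabs_pos M) (Rabs_pos B); unfold N; lra. }
  repeat split; try lra; try (apply HM; rewrite ?Rabs_Ropp, ?Rabs_pos_eq; lra).
  - apply HM; lra.
  - apply (Derive_supp phi M); [exact HM|lra].
Qed.

(* The two bumps are translates of each other, so their integrals cancel and the
   primitive has compact support. *)
Lemma bump_difference_primitive d p q :
  0 < d -> exists phi, test_function phi /\
    forall x, Derive phi x = bump d p x - bump d q x.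
Proof.
  intros Hd.
  set (h := fun x => bump d p x - bump d q x).
  assert (Hc : forall x, continuous h x).
  { intros x; apply @continuous_minus; apply bump_continuous. }
  set (N := Rabs p + Rabs q + d).
  assert (Hp := Rle_abs p); assert (Hp' := Rle_abs (- p)).
  assert (Hq := Rle_abs q); assert (Hq' := Rle_abs (- q)).
  rewrite Rabs_Ropp in Hp', Hq'.
  assert (Hs : forall x, x <= - N \/ N <= x -> h x = 0).
  { intros x Hx; unfold h; rewrite !bump_outside; [ring| |];
    unfold N in Hx; unfold Rabs at 1; destruct Rcase_abs; lra. }
  (* Translation reduces the integral of either bump to that of the bump centred at 0. *)
  assert (T : forall c, Rabs c <= Rabs p + Rabs q ->
             RInt (bump d c) (- N) N = RInt (bump d 0) (- d) d).
  { intros c Hcc; assert (Hc1 := Rle_abs c); assert (Hc2 := Rle_abs (- c)).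
    rewrite Rabs_Ropp in Hc2.
    rewrite (RInt_supp _ (- d + c) (d + c)).
    - rewrite (RInt_ext _ (fun x => scal 1 (bump d 0 (1 * x + - c)))).
      + rewrite (RInt_comp_lin (bump d 0) 1 (- c)).
        * f_equal; ring.
        * apply ex_RInt_cont; intros; apply bump_continuous.
      + intros x _; rewrite bump_translate; unfold scal; simpl; unfold mult; simpl.
        rewrite Rmult_1_l; f_equal; ring.
    - intros; apply bump_continuous.
    - unfold N; lra.
    - unfold N; lra.
    - intros x Hx; apply bump_outside; unfold Rabs; destruct Rcase_abs; lra. }
  assert (H0 : RInt h (- N) N = 0).
  { unfold h; rewrite (RInt_minus (bump d p) (bump d q));
      try (apply ex_RInt_cont; intros; apply bump_continuous).
    rewrite !T by (generalize (Rabs_pos p), (Rabs_pos q); lra).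
    apply Rminus_diag. }
  assert (D : forall x, is_derive (RInt h (- N)) x (h x)).
  { intros x; now apply is_derive_RInt_cont. }
  exists (RInt h (- N)); split.
  2: { intros x; now apply is_derive_unique. }
  split.
  - intros n x; apply ex_derive_n_of_diff_n, diff_n_pred; exists h; split; [exact D|].
    unfold h; apply diff_n_plus; [apply diff_n_bump|].
    (* The subtracted bump is treated as a product with the constant [-1]. *)
    destruct n as [|n]; [exact I|].
    destruct (diff_n_mult _ _ _ (diff_n_const (S n) (-1)) (diff_n_bump (S n) d q)) as [g [Hg Cg]].
    exists g; split; [|exact Cg].
    intros y; apply (is_derive_ext (fun x => -1 * bump d q x)); [|apply Hg].
    intros t; simpl; ring.
  - exists N; intros x Hx; destruct (Rle_dec x 0).
    + rewrite Rabs_left1 in Hx by easy.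
      rewrite (RInt_ext _ (fun _ => 0)).
      * rewrite RInt_const; apply Rmult_0_r.
      * intros y; rewrite Rmin_right, Rmax_left by lra; intros; apply Hs; lra.
    + rewrite Rabs_right in Hx by lra.
      rewrite (RInt_supp h (- N) N); auto; lra.
Qed.

(* The du Bois-Reymond lemma.  If [W p < c < W q], the test function whose
   derivative is a bump at [p] minus a bump at [q] gives
   [(c - W) phi' >= 0] with a nonzero value at [p]. *)
Lemma const_of_integral_Derive_0 (W : R -> R) :
  (forall x, continuous W x) ->
  (forall phi, test_function phi -> integral_R (fun x => W x * Derive phi x) = 0) ->
  forall p q, W p = W q.
Proof.
  intros Hc HW.
  enough (E : forall p q, ~ W p < W q).
  { intros p q; destruct (Rtotal_order (W p) (W q)) as [H|[H|H]]; [|easy|];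
      now apply E in H. }
  intros p q Hpq; set (c := (W p + W q) / 2).
  assert (Lp : locally p (fun x => W x < c)).
  { apply (Hc p (fun y => y < c)), open_lt; unfold c; lra. }
  assert (Lq : locally q (fun x => c < W x)).
  { apply (Hc q (fun y => c < y)), open_gt; unfold c; lra. }
  destruct Lp as [d1 H1], Lq as [d2 H2].
  set (d := Rmin d1 d2).
  assert (Hd : 0 < d) by (apply Rmin_pos; [apply d1|apply d2]).
  destruct (bump_difference_primitive d p q Hd) as [phi [Tphi Dphi]].
  destruct (test_function_C1 _ Tphi) as [Ephi Cphi].
  (* The bound [Rabs p] puts [p] in the open interval from [- N] to [N]. *)
  destruct (test_function_supp phi (Rabs p) Tphi) as [N [HpN [N0 [PN [PN' HN]]]]].
  specialize (HW phi Tphi); rewrite (integral_R_supp _ N) in HW.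
  2: { intros x; now apply @continuous_mult. }
  2: { intros x Hx; rewrite (proj2 (HN x Hx)); ring. }
  assert (I : RInt (Derive phi) (- N) N = 0).
  { rewrite RInt_Derive by auto.
    rewrite PN, PN'; simpl; ring. }
  assert (Cint : forall x, continuous (fun x => (c - W x) * Derive phi x) x).
  { intros x; apply @continuous_mult; [|apply Cphi].
    apply @continuous_minus; [apply continuous_const | apply Hc]. }
  assert (Z : RInt (fun x => (c - W x) * Derive phi x) (- N) N = 0).
  { rewrite (RInt_ext _ (fun x => minus (scal c (Derive phi x)) (W x * Derive phi x))).
    - rewrite (RInt_minus (fun x => scal c (Derive phi x))), (RInt_scal (Derive phi)), I, HW.
      + unfold minus, plus, opp, scal; simpl; unfold mult; simpl; ring.
      + now apply ex_RInt_cont.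
      + apply ex_RInt_cont; intros; apply @continuous_mult; auto using continuous_const.
      + apply ex_RInt_cont; intros; now apply @continuous_mult.
    - intros x _; unfold minus, plus, opp, scal; simpl; unfold mult; simpl; ring. }
  (* By the choice of [d], [W < c] wherever the bump at [p] is nonzero and [c < W] wherever the bump
     at [q] is. *)
  assert (Pos : forall x, 0 <= (c - W x) * Derive phi x).
  { intros x; rewrite Dphi, Rmult_minus_distr_l.
    assert (0 <= (c - W x) * bump d p x).
    { destruct (Rlt_dec (Rabs (x - p)) d) as [L|L].
      - apply Rmult_le_pos; [|apply bump_nonneg].
        enough (W x < c) by lra; apply H1.
        apply Rlt_le_trans with d; [exact L | apply Rmin_l].
      - rewrite bump_outside by lra; lra. }
    assert (0 <= (W x - c) * bump d q x).
    { destruct (Rlt_dec (Rabs (x - q)) d) as [L|L].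
      - apply Rmult_le_pos; [|apply bump_nonneg].
        enough (c < W x) by lra; apply H2.
        apply Rlt_le_trans with d; [exact L | apply Rmin_r].
      - rewrite bump_outside by lra; lra. }
    lra. }
  assert (Pp : 0 < (c - W p) * Derive phi p).
  { assert (W p < c) by (unfold c; lra).
    apply Rmult_lt_0_compat; [lra|]; rewrite Dphi.
    assert (0 < bump d p p).
    { apply bump_pos; rewrite Rminus_diag, Rabs_R0; exact Hd. }
    (* If [p] lay within [d] of [q], then [c < W p] would follow. *)
    rewrite (bump_outside d q p); [lra|].
    apply Rnot_lt_le; intros L.
    enough (c < W p) by lra; apply H2.
    apply Rlt_le_trans with d; [exact L | apply Rmin_r]. }
  (* The primitive [G] of the nonnegative integrand is nondecreasing and vanishes at [- N] and [N],
     hence in between. Its derivative at [p] is then 0, against [Pp]. *)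
  set (G := RInt (fun x => (c - W x) * Derive phi x) (- N)).
  assert (DG : forall x, is_derive G x ((c - W x) * Derive phi x)).
  { intros x; now apply (is_derive_RInt_cont (fun x => (c - W x) * Derive phi x)). }
  assert (Mono : forall s t, s <= t -> G s <= G t).
  { intros s t Hst.
    destruct (MVT_gen G s t (fun x => (c - W x) * Derive phi x)) as [z [_ Hz]].
    - intros; apply DG.
    - intros x _; apply continuity_pt_filterlim, @ex_derive_continuous.
      eexists; apply DG.
    - specialize (Pos z); nra. }
  assert (G0 : forall x, - N <= x <= N -> G x = 0).
  { intros x Hx; apply Rle_antisym.
    - rewrite <- Z; apply Mono; lra.
    - replace 0 with (G (- N)) by (unfold G; now rewrite RInt_point).
      apply Mono; lra. }
  enough (is_derive G p 0).
  { apply is_derive_unique in H; rewrite (is_derive_unique _ _ _ (DG p)) in H; lra. }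
  apply Rabs_def2 in HpN.
  apply (is_derive_ext_loc (fun _ => 0)); [|apply @is_derive_const].
  apply (filter_imp (fun x => - N < x /\ x < N)).
  { intros x Hx; now rewrite G0 by lra. }
  apply filter_and; [now apply open_gt | now apply open_lt].
Qed.

(** * The equation in integrated form *)

(** With [V] a primitive of [g (u x)], integration by parts turns the weak equation into the
    vanishing of the integral of [(w + V) * Derive phi]. Hence [w + V] is constant. *)
Lemma weak_solution_first_integral alpha g u :
  (forall x, continuous (fun x => flux alpha (Derive u x)) x) ->
  (forall x, continuous (fun x => g (u x)) x) ->
  weak_solution alpha g u ->
  forall x, is_derive (fun x => flux alpha (Derive u x)) x (- g (u x)).
Proof.
  intros Hw Hg [_ H].
  set (w := fun x => flux alpha (Derive u x)) in *.
  set (V := RInt (fun x => g (u x)) 0).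
  assert (DV : forall x, is_derive V x (g (u x))).
  { intros x; now apply (is_derive_RInt_cont (fun x => g (u x))). }
  assert (CV : forall x, continuous V x).
  { intros x; apply @ex_derive_continuous; eexists; apply DV. }
  assert (E : forall p q, w p + V p = w q + V q).
  { apply (const_of_integral_Derive_0 (fun x => w x + V x)).
    { intros x; now apply @continuous_plus. }
    intros phi Tphi; specialize (H phi Tphi).
    destruct (test_function_C1 _ Tphi) as [Ephi Cphi].
    assert (Cp : forall x, continuous phi x) by (intros; now apply @ex_derive_continuous).
    destruct (test_function_supp phi 0 Tphi) as [N [_ [N0 [PN [PN' HN]]]]].
    rewrite (integral_R_supp _ N) in H.
    2: { intros x; now apply @continuous_mult. }
    2: { intros x Hx; rewrite (proj2 (HN x Hx)); ring. }
    rewrite (integral_R_supp _ N) in H.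
    2: { intros x; apply @continuous_mult; auto. }
    2: { intros x Hx; rewrite (proj1 (HN x Hx)); ring. }
    rewrite (integral_R_supp _ N).
    2: { intros x; apply @continuous_mult; [apply @continuous_plus|]; auto. }
    2: { intros x Hx; rewrite (proj2 (HN x Hx)); ring. }
    (* Integration by parts: the integrand is the derivative of [V * phi], which vanishes at [- N]
       and [N]. *)
    assert (J : RInt (fun x => g (u x) * phi x + V x * Derive phi x) (- N) N = 0).
    { apply is_RInt_unique.
      replace 0 with (minus (V N * phi N) (V (- N) * phi (- N))).
      - apply (is_RInt_derive (fun x => V x * phi x)).
        + intros x _; apply @is_derive_mult; auto using Rmult_comm.
          now apply Derive_correct.
        + intros x _; apply @continuous_plus; apply @continuous_mult; auto.
      - rewrite PN, PN'.
        unfold minus, plus, opp; simpl; ring. }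
    rewrite (RInt_plus (fun x => g (u x) * phi x) (fun x => V x * Derive phi x)) in J
      by (apply ex_RInt_cont; intros; apply @continuous_mult; auto).
    rewrite <- J, <- H.
    rewrite <- (RInt_plus (fun x => w x * Derive phi x) (fun x => V x * Derive phi x))
      by (apply ex_RInt_cont; intros; apply @continuous_mult; auto).
    apply RInt_ext; intros x _; unfold plus; simpl; ring. }
  intros x; apply (is_derive_ext (fun y => (w 0 + V 0) - V y)).
  - intros y; rewrite (E 0 y); unfold w; simpl; ring.
  - auto_derive; [now exists (g (u x))|].
    change (Derive (fun x => V x) x) with (Derive V x).
    now rewrite (is_derive_unique V x _ (DV x)), Rmult_1_l.
Qed.

(** * The flux, its inverse and its primitive *)

Lemma flux_0 alpha : flux alpha 0 = 0.
Proof. apply Rmult_0_r. Qed.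

Lemma Rabs_flux alpha p : p <> 0 -> Rabs (flux alpha p) = Rpower (Rabs p) (alpha + 1).
Proof.
  intros Hp; apply Rabs_pos_lt in Hp.
  unfold flux; rewrite Rabs_mult, Rpower_plus, Rpower_1 by easy.
  rewrite (Rabs_pos_eq (Rpower _ _)); [easy|apply Rlt_le, exp_pos].
Qed.

Lemma flux_continuous alpha p : -1 < alpha -> continuous (flux alpha) p.
Proof.
  intros Ha; destruct (Req_dec p 0) as [->|Hp].
  - intros P; rewrite flux_0; intros [e He].
    (* The radius is [e] to the power 1/(alpha+1), because |flux alpha y| = |y|^(alpha+1). *)
    exists (mkposreal _ (exp_pos (ln e / (alpha + 1)))); intros y Hy.
    apply He; change (Rabs (y - 0) < exp (ln e / (alpha + 1))) in Hy.
    change (Rabs (flux alpha y - 0) < e).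
    rewrite Rminus_0_r in *.
    destruct (Req_dec y 0) as [->|Hy0].
    { rewrite flux_0, Rabs_R0; apply e. }
    rewrite Rabs_flux by easy; apply Rabs_pos_lt in Hy0.
    unfold Rpower; rewrite <- (exp_ln e) by apply e; apply exp_increasing.
    apply ln_increasing in Hy; [|easy]; rewrite ln_exp in Hy.
    apply Rlt_div_r in Hy; lra.
  - apply @continuous_mult; [|apply continuous_id].
    apply (continuous_comp Rabs (fun y => exp (alpha * ln y))); [apply continuous_Rabs|].
    apply Rabs_pos_lt in Hp.
    apply @ex_derive_continuous; auto_derive; lra.
Qed.

(** The relation between the exponents says (alpha+1) beta + alpha = 0, so the powers of |p| cancel.
    This recovers u' from the flux. *)
Lemma flux_inverse alpha beta p :
  (alpha + 1) * (beta + 1) = 1 -> flux beta (flux alpha p) = p.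
Proof.
  intros H; destruct (Req_dec p 0) as [->|Hp]; [now rewrite !flux_0|].
  unfold flux at 1; rewrite Rabs_flux, Rpower_mult by easy.
  unfold flux; rewrite <- Rmult_assoc, <- Rpower_plus.
  replace (_ + alpha) with 0 by lra.
  apply Rabs_pos_lt in Hp; rewrite Rpower_O by easy; ring.
Qed.

(** The function is |w|^(beta+2), with exponent above 1. At 0 its difference quotient is
    [flux beta h], which tends to 0 by continuity. *)
Lemma is_derive_mult_flux beta w : -1 < beta ->
  is_derive (fun w => w * flux beta w) w ((beta + 2) * flux beta w).
Proof.
  intros Hb; destruct (Rtotal_order w 0) as [Hw|[->|Hw]].
  - apply (is_derive_ext_loc (fun w => w * (exp (beta * ln (- w)) * w))).
    + apply (filter_imp (fun y => y < 0)); [|now apply open_lt].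
      intros y Hy; unfold flux, Rpower; now rewrite Rabs_left.
    + unfold flux, Rpower; rewrite Rabs_left by easy.
      auto_derive; [lra|field; lra].
  - rewrite flux_0, Rmult_0_r.
    apply is_derive_Reals; intros e He.
    assert (C := flux_continuous beta 0 Hb).
    destruct (C (fun y => Rabs (y - 0) < e)) as [d Hd].
    { rewrite flux_0; now exists (mkposreal _ He). }
    exists d; intros h h0 Hh.
    replace (_ - 0) with (flux beta h - 0).
    + apply Hd; change (Rabs (h - 0) < d); now rewrite Rminus_0_r.
    + rewrite Rplus_0_l, Rmult_0_l; field; easy.
  - apply (is_derive_ext_loc (fun w => w * (exp (beta * ln w) * w))).
    + apply (filter_imp (fun y => 0 < y)); [|now apply open_gt].
      intros y Hy; unfold flux, Rpower; now rewrite Rabs_right by lra.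
    + unfold flux, Rpower; rewrite Rabs_right by lra.
      auto_derive; [lra|field; lra].
Qed.

(** * Continuity of the right-hand side *)

Lemma Lipschitz_continuous f x : Lipschitz f -> continuous f x.
Proof.
  intros [L HL] P [e He].
  assert (H : 0 < Rabs L + 1) by (generalize (Rabs_pos L); lra).
  exists (mkposreal _ (Rdiv_lt_0_compat _ _ (cond_pos e) H)); intros y Hy.
  apply He; change (Rabs (y - x) < e / (Rabs L + 1)) in Hy.
  change (Rabs (f y - f x) < e).
  apply Rlt_div_r in Hy; [|easy].
  generalize (HL y x) (Rle_abs L) (Rabs_pos (y - x)); nra.
Qed.

(** The case distinction disappears on writing the positive and negative parts of [f] as (f + |f|)/2
    and (f - |f|)/2. *)
Lemma f_aA_continuous a A f x :
  0 < a -> 0 < A -> continuous f x -> continuous (f_aA a A f) x.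
Proof.
  intros Ha HA Hf.
  apply (continuous_ext
    (fun t => plus (scal (/ (2 * a)) (plus (f t) (Rabs (f t))))
                   (scal (/ (2 * A)) (minus (f t) (Rabs (f t)))))).
  - intros t; unfold f_aA, minus, plus, opp, scal; simpl; unfold mult; simpl.
    destruct Rlt_dec; [|destruct Rlt_dec].
    + rewrite Rabs_right by lra; field; lra.
    + rewrite Rabs_left by lra; field; lra.
    + replace (f t) with 0 by lra; rewrite Rabs_R0; ring.
  - assert (continuous (fun t => Rabs (f t)) x).
    { apply (continuous_comp f Rabs); [exact Hf | apply continuous_Rabs]. }
    apply @continuous_plus; apply @continuous_scal_r;
      [now apply @continuous_plus | now apply @continuous_minus].
Qed.

(** * Conservation of energy and its values at infinity *)

(** On a unit interval where [u] is within [e / 2] of [l], the mean value theorem gives a point with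
    slope [u (x + 1) - u x], smaller than [e]. The condition on [F] provides such intervals and
    holds at both infinities. *)
Lemma exists_small_Derive_at_limit u (F : (R -> Prop) -> Prop) (l : R) :
  ProperFilter F ->
  (forall P, F P -> F (fun x => forall y, x <= y <= x + 1 -> P y)) ->
  (forall x, ex_derive u x) ->
  filterlim u F (locally l) ->
  forall e, 0 < e -> exists x, Rabs (Derive u x) < e /\ Rabs (u x - l) < e.
Proof.
  intros PF HF Hu Hl e He.
  assert (H : F (fun x => Rabs (u x - l) < e / 2)).
  { apply (Hl (fun y => Rabs (y - l) < e / 2)).
    assert (H2 : 0 < e / 2) by lra; now exists (mkposreal _ H2). }
  destruct (filter_ex _ (HF _ H)) as [x Hx].
  destruct (MVT_gen u x (x + 1) (Derive u)) as [z [Hz E]].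
  - intros; now apply Derive_correct.
  - intros; apply continuity_pt_filterlim, @ex_derive_continuous, Hu.
  - rewrite Rmin_left, Rmax_right in Hz by lra; exists z.
    generalize (Hx z Hz); intros; split; [|lra].
    replace (Derive u z) with ((u (x + 1) - l) - (u x - l)) by lra.
    eapply Rle_lt_trans; [apply Rabs_triang|]; rewrite Rabs_Ropp.
    generalize (Hx x ltac:(lra)), (Hx (x + 1) ltac:(lra)); lra.
Qed.

Lemma energy_constant alpha beta g u :
  -1 < alpha -> -1 < beta -> (alpha + 1) * (beta + 1) = 1 ->
  (forall x, continuous g x) -> weak_solution alpha g u ->
  forall x y,
  let energy x := flux alpha (Derive u x) * flux beta (flux alpha (Derive u x))
                  + (beta + 2) * RInt g 0 (u x) in
  energy x = energy y.
Proof.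
  intros Ha Hb Hab Hg Hu x y energy.
  destruct (Hu) as [[Du Cu] _].
  assert (Hw := weak_solution_first_integral alpha g u).
  assert (D : forall t, is_derive energy t 0).
  { intros t; evar_last.
    { apply @is_derive_plus.
      - apply (is_derive_comp (fun w => w * flux beta w)).
        + now apply is_derive_mult_flux.
        + apply Hw; [| |exact Hu].
          * intros r; apply (continuous_comp (Derive u) (flux alpha));
              [apply Cu | now apply flux_continuous].
          * intros r; apply (continuous_comp u g);
              [now apply @ex_derive_continuous | apply Hg].
      - apply is_derive_scal, (is_derive_comp (RInt g 0) u).
        + now apply is_derive_RInt_cont.
        + now apply Derive_correct. }
    (* [flux beta] of the flux is [Derive u], so the two terms are opposite multiples of
       [g (u t) * Derive u t]. *)
    rewrite flux_inverse by easy.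
    unfold plus, scal; simpl; unfold mult; simpl; ring. }
  destruct (MVT_gen energy x y (fun _ => 0)) as [z [_ E]].
  - intros; apply D.
  - intros; apply continuity_pt_filterlim, @ex_derive_continuous; now exists 0.
  - lra.
Qed.

(** The energy is a continuous function of the pair (u', u), and some points bring this pair
    arbitrarily close to (0, l). Being constant, the energy takes its value at (0, l). *)
Lemma energy_value_at_limit alpha beta g u F (l : R) :
  -1 < alpha -> -1 < beta -> (alpha + 1) * (beta + 1) = 1 ->
  (forall x, continuous g x) -> weak_solution alpha g u ->
  ProperFilter F ->
  (forall P, F P -> F (fun x => forall y, x <= y <= x + 1 -> P y)) ->
  filterlim u F (locally l) ->
  flux alpha (Derive u 0) * flux beta (flux alpha (Derive u 0))
    + (beta + 2) * RInt g 0 (u 0) = (beta + 2) * RInt g 0 l.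
Proof.
  intros Ha Hb Hab Hg Hu PF HF Hl.
  set (k := fun p => flux alpha p * flux beta (flux alpha p)).
  set (G := fun y => (beta + 2) * RInt g 0 y).
  assert (Ck : continuous k 0).
  { apply (continuous_comp (flux alpha) (fun w => w * flux beta w)).
    - now apply flux_continuous.
    - apply @ex_derive_continuous; eexists; now apply is_derive_mult_flux. }
  assert (CG : continuous G l).
  { apply @ex_derive_continuous; eexists; apply is_derive_scal.
    now apply is_derive_RInt_cont. }
  assert (k0 : k 0 = 0) by (unfold k; rewrite flux_0; ring).
  change (k (Derive u 0) + G (u 0) = G l).
  set (H := k (Derive u 0) + G (u 0)).
  (* It suffices that the two sides differ by less than every positive [e]; each of the two terms
     contributes [e / 2]. *)
  apply cond_eq; intros e He.
  assert (He2 : 0 < e / 2) by lra.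
  destruct (Ck (ball (k 0) (e / 2)) (locally_ball _ (mkposreal _ He2))) as [d1 H1].
  destruct (CG (ball (G l) (e / 2)) (locally_ball _ (mkposreal _ He2))) as [d2 H2].
  destruct (exists_small_Derive_at_limit u F l PF HF (proj1 (proj1 Hu)) Hl
              (Rmin d1 d2)) as [x [X1 X2]].
  { apply Rmin_pos; [apply d1 | apply d2]. }
  assert (E : H = k (Derive u x) + G (u x)) by now apply energy_constant.
  assert (Y1 : Rabs (k (Derive u x) - k 0) < e / 2).
  { apply H1; change (Rabs (Derive u x - 0) < d1); rewrite Rminus_0_r.
    eapply Rlt_le_trans; [exact X1 | apply Rmin_l]. }
  assert (Y2 : Rabs (G (u x) - G l) < e / 2).
  { apply H2; eapply Rlt_le_trans; [exact X2 | apply Rmin_r]. }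
  rewrite E; replace (_ - G l) with ((k (Derive u x) - k 0) + (G (u x) - G l))
    by (rewrite k0; ring).
  eapply Rle_lt_trans; [apply Rabs_triang | lra].
Qed.

Theorem mainTheorem4 (alpha a A : R) (f df : R -> R)
  (halpha : -1 < alpha) (ha : 0 < a) (haA : a <= A)
  (hC1 : is_C1_on (fun x => -1 <= x <= 1) f df)
  (hfm1 : f (-1) = 0) (hf0 : f 0 = 0) (hf1 : f 1 = 0)
  (hpos : forall x, 0 < x < 1 -> 0 < f x)
  (hneg : forall x, -1 < x < 0 -> f x < 0)
  (hdfm1 : df (-1) < 0) (hdf1 : df 1 < 0)
  (hLip : Lipschitz f)
  (hleft : forall x, x < -1 -> 0 <= f x)
  (hright : forall x, 1 <= x -> f x <= 0)
  (hint : forall t, -1 < t <= 0 -> 0 < RInt (f_aA a A f) t 1) :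
  (exists u : R -> R,
     weak_solution alpha (fun t => (1 + alpha) * f_aA a A f t) u /\
     is_lim u p_infty 1 /\ is_lim u m_infty (-1)) ->
  RInt (f_aA a A f) (-1) 1 = 0.
Proof.
  intros [u [Hu [Lp Lm]]].
  set (g := fun t => (1 + alpha) * f_aA a A f t) in *.
  assert (Cf : forall t, continuous (f_aA a A f) t).
  { intros t; apply f_aA_continuous; [lra|lra|now apply Lipschitz_continuous]. }
  assert (Cg : forall t, continuous g t).
  { intros t; now apply (continuous_scal_r (1 + alpha) (f_aA a A f)). }
  (* This exponent makes [flux beta] the inverse of [flux alpha]. *)
  set (beta := / (alpha + 1) - 1).
  assert (Hab : (alpha + 1) * (beta + 1) = 1) by (unfold beta; field; lra).
  assert (Hb : -1 < beta).
  { unfold beta; assert (0 < / (alpha + 1)) by (apply Rinv_0_lt_compat; lra); lra. }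
  assert (E : (beta + 2) * RInt g 0 1 = (beta + 2) * RInt g 0 (-1)).
  { transitivity (flux alpha (Derive u 0) * flux beta (flux alpha (Derive u 0))
                  + (beta + 2) * RInt g 0 (u 0)); [symmetry|].
    - apply (energy_value_at_limit _ _ _ _ (Rbar_locally p_infty)); auto.
      + apply Rbar_locally_filter.
      + intros P [M HM]; exists M; intros x Hx y Hy; apply HM; lra.
    - apply (energy_value_at_limit _ _ _ _ (Rbar_locally m_infty)); auto.
      + apply Rbar_locally_filter.
      (* The shift by 1 keeps the whole interval from [x] to [x + 1] below [M]. *)
      + intros P [M HM]; exists (M - 1); intros x Hx y Hy; apply HM; lra. }
  apply Rmult_eq_reg_l in E; [|lra].
  apply (Rmult_eq_reg_l (1 + alpha)); [|lra].
  transitivity (RInt g (-1) 1).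
  { symmetry; apply (RInt_scal (f_aA a A f)); now apply ex_RInt_cont. }
  rewrite Rmult_0_r; apply (Rplus_eq_reg_l (RInt g 0 (-1))).
  rewrite Rplus_0_r; etransitivity; [|exact E].
  apply (RInt_Chasles g); now apply ex_RInt_cont.
Qed.
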